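(* Let $B \subseteq \mathbb{R}^2$ be the convex hull of $\{(0,0), (1.5,1), (2,2), (1, 1.5)\}$. For every integer $n\ge 2$, let $P_n\subseteq \mathbb{R}^n$ be the Cartesian product $P_n := B \times [-\frac12,\frac12]^{n-2}$. Consider the problem of maximizing $x_1 - x_2$ over $x\in C\cap S$ with $C = P_n$ and $S=\mathbb{Z}^n$, and let $\mathcal{D}$ be the family of variable disjunctions. The optimal value is $0$ and there is a branch-and-bound algorithm based on $\mathcal D$ which certifies $x_1 - x_2 \leq 0$ in $O(1)$ steps. However, any cutting plane proof of $x_1 - x_2 \leq 0$ based on $\mathcal{D}$ has infinite length (i.e., there is no cutting plane proof of finite length).
   Context: A valid disjunction for a closed set $S\subseteq\mathbb{R}^n$ is a finite union $D=Q_1\cup\dots\cup Q_k$ of closed convex sets with $S\subseteq D$. The variable disjunctions are $D_{i,K}=\{x\in\mathbb{R}^n: x_i\le K\}\cup\{x\in\mathbb{R}^n: x_i\ge K+1\}$, $i\in\{1,\dots,n\}$, $K\in\mathbb{Z}$. A cutting plane for a convex set $C$ derived from $D$ is a halfspace $H$ with $C\cap D\subseteq H$. A cutting plane proof based on $\mathcal{D}$ with respect to $C\cap S$ of length $N$ for an inequality $\langle c,x\rangle\le\gamma$ valid for $C\cap S$ is a sequence of halfspaces $H_1,\dots,H_N$ for which there are $D_1,\dots,D_N\in\mathcal{D}$ such that for each $i=0,\dots,N-1$, $H_{i+1}$ is a cutting plane derived from $D_{i+1}$ for $C_i:=C\cap\bigcap_{j=1}^{i}H_j$ (with $C_0=C$),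 and $\langle c,x\rangle\le\gamma$ is valid for all points of $C_N$. Branch-and-bound algorithm based on $\mathcal{D}$ (for $\sup\{\langle c,x\rangle: x\in C\cap S\}$): initialize a list $\mathcal{L}:=\{C\}$ and $LB:=-\infty$. While $\mathcal{L}\ne\emptyset$: choose $N\in\mathcal{L}$ and remove it from $\mathcal{L}$; if $N=\emptyset$ continue the loop; otherwise find $\bar x\in\arg\max\{\langle c,x\rangle:x\in N\}$ (stop with an exception if there is none). If $\langle c,\bar x\rangle>LB$: if $\bar x\in S$ set $LB:=\langle c,\bar x\rangle$; if $\bar x\notin S$ choose $D=Q_1\cup\dots\cup Q_k\in\mathcal{D}$ with $\bar x\notin D\cap N$ and add $Q_1\cap N,\dots,Q_k\cap N$ to $\mathcal{L}$ (stop if no such disjunction exists). At the end, if $LB=-\infty$ report infeasibility, otherwise return the $\bar x\in S$ corresponding to the current $LB$ as optimal. A specific strategy for the choices gives a specific algorithm. The stopping criterion may be changed so that the algorithm stops when validity of an upper bound $\langle c,x\rangle\le\gamma$ is certified. *)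

(* Defs.v *)
(* MathComp / MathComp-Analysis. Vectors of R^n are row vectors 'rV[R]_n. *)
From HB Require Import structures.
From mathcomp Require Import all_boot all_order all_algebra.
From mathcomp Require Import all_classical all_reals all_analysis.
From mathcomp Require Import ring.
Import Order.TTheory GRing.Theory Num.Theory.
Import numFieldNormedType.Exports.

Set Implicit Arguments.
Unset Strict Implicit.
Unset Printing Implicit Defensive.

Local Open Scope classical_set_scope.
Local Open Scope ring_scope.

Section General.
Context {R : realType} {n : nat}.
Local Notation V := 'rV[R]_n.
Implicit Types (C S N : set V) (c x : V).

Definition dot (u v : V) : R := \sum_(i < n) u 0 i * v 0 i.

Definition halfspace (H : set V) : Prop :=
  exists a : V, exists d : R, a != 0 /\ H = [set x | dot a x <= d].

Definition argmax c N : set V :=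
  [set x | N x /\ forall y, N y -> dot c y <= dot c x].

(* sup {<c,x> : x in X}, equal to -oo when X is empty *)
Definition optimal_value c (X : set V) : \bar R :=
  ereal_sup [set (dot c x)%:E | x in X].

(* A disjunction Q_1 \/ ... \/ Q_k is kept as the list of its terms, since
   branching needs the Q_i and not only their union. *)
Definition disjunction : Type := seq (set V).

Definition dset (D : disjunction) : set V := [set x | exists2 Q, Q \in D & Q x].

Definition valid_disjunction S (D : disjunction) : Prop :=
  (forall Q, Q \in D -> closed Q /\ convex_set Q) /\ S `<=` dset D.

Definition integer_points : set V := [set x | forall i, x 0 i \is a Num.int].

Definition variable_disjunction (i : 'I_n) (K : int) : disjunction :=
  [:: [set x : V | x 0 i <= K%:~R]; [set x : V | (K + 1)%:~R <= x 0 i]].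

Definition variable_disjunctions : set disjunction :=
  [set D | exists i K, D = variable_disjunction i K].

Definition cutting_plane C (D : disjunction) (H : set V) : Prop :=
  halfspace H /\ C `&` dset D `<=` H.

(* C_i, with the halfspaces indexed from 0: H_{j+1} is [H j] *)
Definition cp_relaxation C (N : nat) (H : 'I_N -> set V) (i : nat) : set V :=
  C `&` \bigcap_(j in [set j : 'I_N | (j < i)%N]) H j.

Definition cutting_plane_proof (DD : set disjunction) C c (gamma : R)
    (N : nat) (H : 'I_N -> set V) : Prop :=
  (exists D : 'I_N -> disjunction, forall i : 'I_N,
     DD (D i) /\ cutting_plane (cp_relaxation C H i) (D i) (H i)) /\
  (forall x, cp_relaxation C H N x -> dot c x <= gamma).

(* [BBRun L xbest]: L is the list of open nodes and xbest the point of S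
   giving the current LB ([None] while LB = -oo).
   [BBStop]: one of the two exceptional exits. *)
Inductive bb_state : Type :=
  | BBRun of seq (set V) & option V
  | BBStop.

Definition LB c (xbest : option V) : \bar R :=
  if xbest is Some x then (dot c x)%:E else -oo%E.

(* One iteration of the while loop, for some admissible choice of the node N,
   of the maximizer x and of the disjunction D. *)
Inductive bb_step (DD : set disjunction) S c : bb_state -> bb_state -> Prop :=
  | bb_empty L1 L2 xbest :
      bb_step DD S c (BBRun (L1 ++ set0 :: L2) xbest) (BBRun (L1 ++ L2) xbest)
  | bb_no_max L1 N L2 xbest :
      N !=set0 -> argmax c N = set0 ->
      bb_step DD S c (BBRun (L1 ++ N :: L2) xbest) BBStop
  | bb_bounded L1 N L2 xbest x :
      argmax c N x -> ((dot c x)%:E <= LB c xbest)%E ->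
      bb_step DD S c (BBRun (L1 ++ N :: L2) xbest) (BBRun (L1 ++ L2) xbest)
  | bb_update L1 N L2 xbest x :
      argmax c N x -> (LB c xbest < (dot c x)%:E)%E -> S x ->
      bb_step DD S c (BBRun (L1 ++ N :: L2) xbest) (BBRun (L1 ++ L2) (Some x))
  | bb_branch L1 N L2 xbest x D :
      argmax c N x -> (LB c xbest < (dot c x)%:E)%E -> ~ S x ->
      DD D -> ~ (dset D `&` N) x ->
      bb_step DD S c (BBRun (L1 ++ N :: L2) xbest)
                     (BBRun ([seq Q `&` N | Q <- D] ++ L1 ++ L2) xbest)
  | bb_no_disjunction L1 N L2 xbest x :
      argmax c N x -> (LB c xbest < (dot c x)%:E)%E -> ~ S x ->
      (forall D, DD D -> (dset D `&` N) x) ->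
      bb_step DD S c (BBRun (L1 ++ N :: L2) xbest) BBStop.

(* A specific algorithm is a strategy resolving all choices: it performs an
   admissible iteration while L is nonempty, and stays put once it has ended. *)
Definition bb_algorithm (DD : set disjunction) S c
    (A : bb_state -> bb_state) : Prop :=
  forall s, match s with
            | BBRun (_ :: _) _ => bb_step DD S c s (A s)
            | _ => A s = s
            end.

(* Started on C, the algorithm ends normally (L empty) after at most T
   iterations, with a final LB proving <c,x> <= gamma on C `&` S. *)
Definition bb_certifies (A : bb_state -> bb_state) C c (gamma : R)
    (T : nat) : Prop :=
  exists2 t, (t <= T)%N & exists2 xbest,
    iter t A (BBRun [:: C] None) = BBRun [::] xbest &
    (LB c xbest <= gamma%:E)%E.

Lemma variable_disjunctions_valid (D : disjunction) :
  variable_disjunctions D -> valid_disjunction integer_points D.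
Proof.
move=> [i [K ->]]; split=> [Q|x xZ].
  rewrite !inE => /orP[] /eqP ->; split.
  - have -> : [set x : V | x 0 i <= K%:~R] =
        (fun x : V => x 0 i) @^-1` [set y | y <= K%:~R] by [].
    apply: preimage_closed; last exact: closed_le.
    by move=> x _; exact: coord_continuous.
  - move=> x y l; rewrite !inE /= => hx hy; rewrite !mxE.
    have l0 : 0 <= l%:num by [].
    have l1 : 0 <= 1 - l%:num by rewrite subr_ge0.
    have -> : K%:~R = l%:num * K%:~R + (1 - l%:num) * K%:~R :> R by ring.
    by rewrite lerD// ler_wpM2l.
  - have -> : [set x : V | (K + 1)%:~R <= x 0 i] =
        (fun x : V => x 0 i) @^-1` [set y | (K + 1)%:~R <= y] by [].
    apply: preimage_closed; last exact: closed_ge.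
    by move=> x _; exact: coord_continuous.
  - move=> x y l; rewrite !inE /= => hx hy; rewrite !mxE.
    have l0 : 0 <= l%:num by [].
    have l1 : 0 <= 1 - l%:num by rewrite subr_ge0.
    have -> : (K + 1)%:~R =
        l%:num * (K + 1)%:~R + (1 - l%:num) * (K + 1)%:~R :> R by ring.
    by rewrite lerD// ler_wpM2l.
have /intrP[z xz] := xZ i.
have [zK|Kz] := leP z K.
  by exists [set y : V | y 0 i <= K%:~R]; rewrite ?inE ?eqxx//= xz ler_int.
exists [set y : V | (K + 1)%:~R <= y 0 i]; first by rewrite !inE eqxx orbT.
by rewrite /= xz ler_int lezD1.
Qed.

End General.

Arguments disjunction : clear implicits.
Arguments bb_state : clear implicits.
Arguments integer_points : clear implicits.
Arguments variable_disjunctions : clear implicits.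

Section Instance.
Context (R : realType).

Definition point2 (a b : R) : 'rV[R]_2 := \row_(j < 2) [:: a; b]`_j.

(* smallest convex set containing the four points, i.e. their convex hull *)
Definition B : set 'rV[R]_2 :=
  smallest (@convex_set R 'rV[R]_2)
    [set point2 0 0; point2 (3 / 2) 1; point2 2 2; point2 1 (3 / 2)].

Definition box (m : nat) : set 'rV[R]_m :=
  [set y | forall i, - (1 / 2) <= y 0 i <= 1 / 2].

(* The space R^n, n >= 2, is R^(2 + m) with m = n - 2. *)
Definition P (m : nat) : set 'rV[R]_(2 + m) :=
  [set row_mx b y | b in B & y in @box m].

Definition objective (m : nat) : 'rV[R]_(2 + m) :=
  row_mx (point2 1 (- 1)) 0.

Lemma dot_objective (m : nat) (x : 'rV[R]_(2 + m)) :
  dot (objective m) x = x 0 (lshift m 0) - x 0 (lshift m 1).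
Proof.
rewrite /dot big_split_ord /= [X in _ + X]big1 ?addr0 => [|i _].
  by rewrite !big_ord_recl big_ord0 !row_mxEl !mxE /= mul1r mulN1r addr0;
    congr (_ - x 0 _); apply: val_inj.
by rewrite row_mxEr mxE mul0r.
Qed.

End Instance.

Arguments P R m : clear implicits.

(* Main.v *)
Require Import Defs.
From mathcomp Require Import all_boot all_order all_algebra.
From mathcomp Require Import all_classical all_reals all_analysis.
From mathcomp Require Import ring lra.
Import Order.TTheory GRing.Theory Num.Theory.
Import numFieldNormedType.Exports.

Set Implicit Arguments.
Unset Strict Implicit.
Unset Printing Implicit Defensive.

Local Open Scope classical_set_scope.
Local Open Scope ring_scope.

(** Over the quadrilateral [B] the objective [x_1 - x_2] is at most 1/2, so it
is at most 0 at integer points, with equality at the origin.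

Branch-and-bound succeeds because branching on [x_1] and then on [x_2] isolates
the pieces of [B] on which the objective is nonpositive ([bb_reaches]). Five
iterations suffice in every dimension, the further coordinates taking no part
in the branching. As an algorithm has to make its choices by a function defined
on all states, the run is turned into a strategy by following shortest paths
to a certifying state ([shortest_path_strategy]).

A cutting plane, on the contrary, has to be valid for both sides of a
disjunction at once, hence for the convex hull of what they leave. Suppose that
a convex set contains (0, 0), (2, 2), (1, 1 - e) and (1 + e, 1) for some e > 0,
with all further coordinates 0. A variable disjunction on [x_1] contains the
first three points, one on [x_2] contains the first two and the last, and any
other contains all four. In each case the hull of the points that the cut must
keep contains the same configuration for e / (1 + e) ([wedge_cut]). So, starting
from e = 1/3 in [P], every relaxation occurring in a cutting plane proof still
contains a point (1 + e, 1) with e > 0, where the objective is positive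
([no_cutting_plane_proof]). *)

(** * Strategies following shortest paths *)

Fixpoint reaches (T : Type) (step : T -> T -> Prop) (goal : T -> Prop)
    (t : nat) (s : T) : Prop :=
  if t is t'.+1 then goal s \/ exists2 s', step s s' & reaches step goal t' s'
  else goal s.

Lemma reachesW (T : Type) (step : T -> T -> Prop) (goal : T -> Prop)
    (t u : nat) (s : T) :
  (t <= u)%N -> reaches step goal t s -> reaches step goal u s.
Proof.
elim: t u s => [|t IH] [|u] s //=; first by left.
rewrite ltnS => tu [gs|[s' ss' /(IH u) gs']]; first by left.
by right; exists s'; auto.
Qed.

(** A strategy is a single function on all states, so a favourable run can be
followed only if each of its states determines the next one. Always moving to
a successor whose distance to the goal is least resolves this: whatever states
the run visits, even repeatedly, a goal at distance [t] is met within [t]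
iterations. *)
Lemma shortest_path_strategy (T : Type) (step : T -> T -> Prop)
    (stop goal : T -> Prop) :
  (forall s, ~ stop s -> exists s', step s s') ->
  (forall s s', step s s' -> ~ stop s) ->
  exists A : T -> T,
    [/\ forall s, stop s -> A s = s,
        forall s, ~ stop s -> step s (A s) &
        forall t s, reaches step goal t s ->
          exists2 u, (u <= t)%N & goal (iter u A s)].
Proof.
move=> total live.
have next s : exists s', [/\ stop s -> s' = s, ~ stop s -> step s s' &
    ~ goal s -> forall t, reaches step goal t.+1 s -> reaches step goal t s'].
  have [ss|ns] := pselect (stop s).
    by exists s; split=> // ng t [//|[s' /live]].
  have [[gs [t rs]]|no] :=
      pselect (~ goal s /\ exists t, reaches step goal t.+1 s); last first.
    by have [s' ss'] := total s ns; exists s'; split=> // gs t rs;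
      case: no; split=> //; exists t.
  have ex : exists t, `[< reaches step goal t.+1 s >].
    by exists t; apply/asboolP.
  (* [u.+1] is the distance from [s] to the goal, so the successor reached here
     serves every larger bound as well. *)
  have [u /asboolP /= [//|[s' ss' rs']] umin] := ex_minnP ex.
  exists s'; split=> // _ v rv; apply: reachesW rs'.
  by apply: umin; apply/asboolP.
have [A hA] := choice next.
exists A; split=> [s|s|t]; [by case: (hA s)|by case: (hA s)|].
elim: t => [|t IH] s rs; first by exists 0%N.
have [gs|gs] := pselect (goal s); first by exists 0%N.
have [_ _ /(_ gs t rs)/IH[u ut gu]] := hA s.
by exists u.+1 => //; rewrite iterSr.
Qed.

(** * Convex sets, disjunctions and branch-and-bound steps *)

Section Convexity.
Context {R : realType} {n : nat}.
Implicit Types (A : set 'rV[R]_n) (c : 'rV[R]_n) (gamma : R).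

Lemma convex_setE A : convex_set A <->
  (forall x y (t : R), 0 <= t <= 1 -> A x -> A y -> A (t *: x + (1 - t) *: y)).
Proof.
split=> [cA x y t /andP[t0 t1] Ax Ay|cA x y t].
  have := cA x y (Itv01 t0 t1); rewrite !inE; exact.
rewrite !inE => Ax Ay; apply: (cA x y t%:num) => //.
by apply/andP.
Qed.

Lemma dot_lin (a x y : 'rV[R]_n) (s t : R) :
  dot a (s *: x + t *: y) = s * dot a x + t * dot a y.
Proof.
rewrite /dot !mulr_sumr -big_split /=; apply: eq_bigr => i _.
by rewrite !mxE; ring.
Qed.

Lemma convex_dot_le (a : 'rV[R]_n) (d : R) : convex_set [set x | dot a x <= d].
Proof.
apply/convex_setE => x y t /andP[t0 t1] /= ax ay; rewrite dot_lin.
have := ler_wpM2l t0 ax.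
have /ler_wpM2l/(_ _ _ ay) : 0 <= 1 - t by lra.
lra.
Qed.

Lemma convex_halfspace A : halfspace A -> convex_set A.
Proof. by move=> [a [d [_ ->]]]; exact: convex_dot_le. Qed.

Lemma convex_setI A1 A2 :
  convex_set A1 -> convex_set A2 -> convex_set (A1 `&` A2).
Proof.
move=> /convex_setE c1 /convex_setE c2.
apply/convex_setE => x y t t01 [? ?] [? ?].
by split; [apply: c1|apply: c2].
Qed.

Lemma convex_bigcap (I : Type) (D : set I) (F : I -> set 'rV[R]_n) :
  (forall i, D i -> convex_set (F i)) -> convex_set (\bigcap_(i in D) F i).
Proof.
move=> cF; apply/convex_setE => x y t t01 Fx Fy i Di.
by move/convex_setE : (cF i Di); apply=> //; [exact: Fx|exact: Fy].
Qed.

(** Only the coordinate [i] has to be integral: this is why a cut derived from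
a variable disjunction keeps fractional points as well. *)
Lemma dset_variable_disjunction (i : 'I_n) (K : int) (x : 'rV[R]_n) :
  x 0 i \is a Num.int -> dset (variable_disjunction i K) x.
Proof.
move=> /intrP[z xz]; have [zK|Kz] := leP z K.
  by exists [set y : 'rV_n | y 0 i <= K%:~R]; rewrite ?inE ?eqxx//= xz ler_int.
exists [set y : 'rV_n | (K + 1)%:~R <= y 0 i]; first by rewrite !inE eqxx orbT.
by rewrite /= xz ler_int lezD1.
Qed.

Definition bb_certified c gamma (s : bb_state R n) : Prop :=
  exists2 xbest, s = BBRun [::] xbest & (LB c xbest <= gamma%:E)%E.

(** Every situation with an open node is covered by a branch of the loop, the
exceptional exits included; classically this lets a strategy be defined on
states that the run of interest never meets. *)
Lemma bb_step_total DD S c L (xbest : option 'rV[R]_n) :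
  L <> [::] -> exists s, bb_step DD S c (BBRun L xbest) s.
Proof.
case: L => [//|N L] _; rewrite -[N :: L]/([::] ++ N :: L).
have [->|N0] := eqVneq N set0; first by eexists; exact: bb_empty.
have [M0|/set0P[x xN]] := eqVneq (argmax c N) set0.
  by exists BBStop; apply: bb_no_max => //; exact/set0P.
have [le|lt] := leP (dot c x)%:E (LB c xbest).
  by eexists; exact: bb_bounded xN le.
have [Sx|nSx] := pselect (S x); first by eexists; exact: bb_update xN lt Sx.
have [[D [DDD Dx]]|no] := pselect (exists D, DD D /\ ~ (dset D `&` N) x).
  by eexists; exact: bb_branch xN lt nSx DDD Dx.
exists BBStop; apply: (bb_no_disjunction _ _ xN lt nSx) => D DDD.
by apply: contrapT => Dx; apply: no; exists D.
Qed.

End Convexity.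

(** * The polytope and its optimal value *)

Section Polytope.
Context {R : realType} {m : nat}.
Local Notation V := 'rV[R]_(2 + m).
Implicit Types (x : V) (A C H : set V) (e : R).

(** Everything happens in the plane of the first two coordinates: the other
coordinates are kept at 0, the only integer of [-1/2, 1/2]. *)
Definition pt (a b : R) : V := row_mx (point2 a b) 0.

Local Notation i0 := (lshift m (0 : 'I_2)).
Local Notation i1 := (lshift m (1 : 'I_2)).

Lemma pt0 a b : pt a b 0 i0 = a.
Proof. by rewrite row_mxEl mxE. Qed.

Lemma pt1 a b : pt a b 0 i1 = b.
Proof. by rewrite row_mxEl mxE. Qed.

Lemma ptr a b j : pt a b 0 (rshift 2 j) = 0.
Proof. by rewrite row_mxEr mxE. Qed.

Lemma pt_int a b :
  a \is a Num.int -> b \is a Num.int -> integer_points R (2 + m) (pt a b).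
Proof.
move=> aZ bZ i; case: (split_ordP i) => j ->; last by rewrite ptr.
by case: j => -[|[|//]] ?; rewrite row_mxEl mxE.
Qed.

Lemma segment_pt A (t a b a1 b1 a2 b2 : R) : convex_set A ->
  A (pt a1 b1) -> A (pt a2 b2) -> 0 <= t <= 1 ->
  a = t * a1 + (1 - t) * a2 -> b = t * b1 + (1 - t) * b2 -> A (pt a b).
Proof.
move=> /convex_setE cA A1 A2 t01 -> ->; have := cA _ _ _ t01 A1 A2.
rewrite /pt !scale_row_mx add_row_mx !scaler0 addr0; congr (A (row_mx _ _)).
by apply/rowP => j; rewrite !mxE; case: j => -[|[|//]].
Qed.

Lemma convex_P : convex_set (P R m).
Proof.
have /convex_setE cB : convex_set (@B R) by apply: convex_bigcap => A [].
apply/convex_setE => x y t t01 [b Bb [y1 y1box <-]] [b' Bb' [y2 y2box <-]].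
exists (t *: b + (1 - t) *: b'); first exact: cB.
exists (t *: y1 + (1 - t) *: y2); last by rewrite !scale_row_mx add_row_mx.
by move=> i; have := y1box i; have := y2box i; rewrite !mxE; nra.
Qed.

Lemma P_vertex a b :
  [set point2 0 0; point2 (3 / 2) 1; point2 2 2; point2 1 (3 / 2)]
    (point2 a b) -> P R m (pt a b).
Proof.
move=> vab; exists (point2 a b); first exact: sub_gen_smallest.
by exists 0 => // i; rewrite mxE; lra.
Qed.

Lemma P00 : P R m (pt 0 0). Proof. by apply: P_vertex; do 3 left. Qed.
Lemma P321 : P R m (pt (3 / 2) 1).
Proof. by apply: P_vertex; do 2 left; right. Qed.
Lemma P22 : P R m (pt 2 2). Proof. by apply: P_vertex; left; right. Qed.

Lemma P11 : P R m (pt 1 1).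
Proof. by apply: (segment_pt (t := 1 / 2) convex_P P00 P22); lra. Qed.

Lemma P_1_23 : P R m (pt 1 (2 / 3)).
Proof. by apply: (segment_pt (t := 2 / 3) convex_P P321 P00); lra. Qed.

Lemma dot_point2 (a b : R) (y : 'rV[R]_2) :
  dot (point2 a b) y = a * y 0 0 + b * y 0 1.
Proof.
rewrite /dot !big_ord_recl big_ord0 !mxE /= addr0.
by congr (_ + _ * y 0 _); apply: val_inj.
Qed.

(** These are the edges of [B] meeting at its vertex (3/2, 1), where the
objective is largest; they give all the upper bounds used for
branch-and-bound. *)
Lemma P_edges x : P R m x ->
  2 * x 0 i0 <= 3 * x 0 i1 /\ 2 * x 0 i0 - x 0 i1 <= 2.
Proof.
have Ble (a b d : R) (y : 'rV[R]_2) : d >= 0 -> a * (3 / 2) + b <= d ->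
    a * 2 + b * 2 <= d -> a + b * (3 / 2) <= d ->
    B y -> a * y 0 0 + b * y 0 1 <= d.
  move=> h1 h2 h3 h4; rewrite -dot_point2.
  apply: (smallest_sub (X := [set y | dot (point2 a b) y <= d])).
    exact: convex_dot_le.
  move=> {}y /=.
  by move=> [[[|]|]|] ->; rewrite dot_point2 !mxE /=; lra.
move=> [b Bb [y _ <-]]; rewrite !row_mxEl.
have := Ble 2 (- 3) 0 b _ _ _ _ Bb; have := Ble 2 (- 1) 2 b _ _ _ _ Bb.
by split; lra.
Qed.

Lemma dot_obj_pt a b : dot (objective R m) (pt a b) = a - b.
Proof. by rewrite dot_objective pt0 pt1. Qed.

Lemma argmax_pt N a b : N (pt a b) ->
  (forall x, N x -> x 0 i0 - x 0 i1 <= a - b) ->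
  argmax (objective R m) N (pt a b).
Proof.
by move=> Nab le; split=> // x Nx; rewrite dot_obj_pt dot_objective; exact: le.
Qed.

(** The two edges bound the objective by 1/2, and it is integral at integer
points. *)
Lemma optimal_value_P :
  optimal_value (objective R m) (P R m `&` integer_points R (2 + m)) = 0%:E.
Proof.
apply/eqP; rewrite eq_le; apply/andP; split.
  apply: ge_ereal_sup => _ [x [Px xZ] <-]; rewrite lee_fin dot_objective.
  have [e1 e2] := P_edges Px.
  have /intrP[z zE] : x 0 i0 - x 0 i1 \is a Num.int by rewrite rpredB.
  rewrite zE (ler_int _ z 0) -ltzD1 -(ltr_int R) -zE; lra.
apply: ereal_sup_ubound; exists (pt 0 0); last by rewrite dot_obj_pt subrr.
by split; [exact: P00|apply: pt_int].
Qed.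

(** * A branch-and-bound run of five iterations *)

(** The root has maximizer (3/2, 1) and is split on [x_1 <= 1] or [x_1 >= 2].
On the left the maximum drops to 1/3, at (1, 2/3), and splitting on [x_2 <= 0]
or [x_2 >= 1] yields two nodes on which the maximum is 0, at the integer points
(0, 0) and (1, 1). On the right the maximum is 0 too, at (2, 2). The maximizers
are taken with all further coordinates 0, which makes the run independent of
the dimension. *)
Lemma bb_reaches :
  reaches (bb_step (variable_disjunctions R (2 + m)) (integer_points R (2 + m))
             (objective R m))
    (bb_certified (objective R m) 0) 5 (BBRun [:: P R m] None).
Proof.
have nint i (K : int) a : K%:~R < a -> a < (K + 1)%:~R ->
    forall x, x 0 i = a -> ~ dset (@variable_disjunction R (2 + m) i K) x.
  move=> Ka aK x xa [Q]; rewrite !inE => /orP[] /eqP -> /=; rewrite xa; lra.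
have ndint i (K : int) a : K%:~R < a -> a < (K + 1)%:~R ->
    forall x, x 0 i = a -> ~ integer_points R (2 + m) x.
  move=> Ka aK x xa xZ; apply: (nint i K a Ka aK x xa).
  exact: dset_variable_disjunction.
right; eexists.
  apply: (bb_branch [::] _ (x := pt (3 / 2) 1)
            (D := variable_disjunction i0 1)).
  - apply: argmax_pt; first exact: P321.
    by move=> x /P_edges[]; lra.
  - by rewrite ltNyr.
  - by apply: (ndint i0 1 (3 / 2)); rewrite ?pt0//; lra.
  - by exists i0, 1.
  - by case=> + _; apply: (nint i0 1 (3 / 2)); rewrite ?pt0//; lra.
right; eexists.
  apply: (bb_branch [::] _ (x := pt 1 (2 / 3))
            (D := variable_disjunction i1 0)).
  - apply: argmax_pt; first by split; [rewrite /= pt0|exact: P_1_23].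
    by move=> x [/= x1 /P_edges[]]; lra.
  - by rewrite ltNyr.
  - by apply: (ndint i1 0 (2 / 3)); rewrite ?pt1//; lra.
  - by exists i1, 0.
  - by case=> + _; apply: (nint i1 0 (2 / 3)); rewrite ?pt1//; lra.
right; eexists.
  apply: (bb_update _ [::] _ (x := pt 0 0)).
  - apply: argmax_pt.
      by split; [rewrite /= pt1|split; [rewrite /= pt0 ler01|exact: P00]].
    by move=> x [/= x2 [/= x1 /P_edges[]]]; lra.
  - by rewrite ltNyr.
  - exact: pt_int.
right; eexists.
  apply: (bb_bounded _ _ [::] _ (x := pt 1 1)).
    apply: argmax_pt.
      by split; [rewrite /= pt1|split; [rewrite /= pt0|exact: P11]].
    by move=> x [/= x2 [/= x1 /P_edges[]]]; lra.
  by rewrite /= !dot_obj_pt !subrr.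
right; eexists.
  apply: (bb_bounded _ _ [::] _ (x := pt 2 2)).
    apply: argmax_pt; first by split; [rewrite /= pt0|exact: P22].
    by move=> x [/= x1 /P_edges[]]; lra.
  by rewrite /= !dot_obj_pt !subrr.
by eexists; [reflexivity|rewrite /= dot_obj_pt subrr].
Qed.

(** * Cutting planes never remove the wedge *)

(** A convex [A] also contains the diagonal from (0, 0) to (2, 2); the other two
points lie at distance [e] from its midpoint (1, 1), vertically and
horizontally, and both have objective [e]. Each has one integral coordinate
of the first two, so no variable disjunction excludes both. *)
Definition wedge A e : Prop :=
  [/\ A (pt 0 0), A (pt 2 2), A (pt 1 (1 - e)) & A (pt (1 + e) 1)].

(** Either of the two points off the diagonal produces the other one, with a
smaller parameter: the segment from (1, 1 - e) to (2, 2) crosses the line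
[x_2 = 1] at [x_1 = 1 + e / (1 + e)], and the segment from (1 + e, 1) to (0, 0)
crosses [x_1 = 1] at [x_2 = 1 - e / (1 + e)]. *)
Lemma wedge_shrink A e : convex_set A -> 0 < e -> A (pt 0 0) -> A (pt 2 2) ->
  A (pt 1 (1 - e)) \/ A (pt (1 + e) 1) -> wedge A (e / (1 + e)).
Proof.
move=> cA e0 A0 A2 Ae; set t := (1 + e)^-1.
have A1 : A (pt 1 1) by apply: (segment_pt (t := 1 / 2) cA A0 A2); lra.
have te : t * (1 + e) = 1 by rewrite mulVf//; lra.
have t0 : 0 < t by rewrite invr_gt0; lra.
have t01 : 0 <= t <= 1 by nra.
(* The parameter e / (1 + e) is 1 - t, so the two points off the diagonal are
   convex combinations with weights t and 1 - t. *)
rewrite /wedge -/t; case: Ae => Ae; split=> //.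
- by apply: (segment_pt cA Ae A1 t01); lra.
- by apply: (segment_pt cA Ae A2 t01); lra.
- by apply: (segment_pt cA Ae A0 t01); lra.
- by apply: (segment_pt cA Ae A1 t01); lra.
Qed.

(** A cut derived from a disjunction on [x_1] keeps (1, 1 - e), one derived from
a disjunction on [x_2] keeps (1 + e, 1), and one derived from a disjunction on
another coordinate keeps both. The diagonal points have integral coordinates,
and a halfspace is convex, so what is kept already spans a smaller wedge. *)
Lemma wedge_cut C D H e : convex_set C -> 0 < e -> wedge C e ->
  variable_disjunctions R (2 + m) D -> cutting_plane C D H ->
  wedge (C `&` H) (e / (1 + e)).
Proof.
move=> cC e0 [C0 C2 Ce1 Ce2] [i [K ->]] [hH CDH].
have keep a b : C (pt a b) -> pt a b 0 i \is a Num.int -> (C `&` H) (pt a b).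
  move=> Cab abZ; split=> //; apply: CDH; split=> //.
  exact: dset_variable_disjunction.
have int2 a : a \is a Num.int -> pt a a 0 i \is a Num.int.
  by move=> aZ; exact: pt_int.
apply: (wedge_shrink (convex_setI cC (convex_halfspace hH)) e0).
- by apply: keep => //; apply: int2.
- by apply: keep => //; apply: int2.
case: (split_ordP i) => j ij; last by left; apply: keep => //; rewrite ij ptr.
have [j0|j1] : j = 0 \/ j = 1.
  by case: j {ij} => -[|[|//]] ?; [left|right]; apply: val_inj.
- by left; apply: keep => //; rewrite ij j0 pt0.
- by right; apply: keep => //; rewrite ij j1 pt1.
Qed.

Lemma wedge_P : wedge (P R m) (1 / 3).
Proof.
split; [exact: P00|exact: P22| |].
  by have := P_1_23; congr (P R m (pt _ _)); lra.
by apply: (segment_pt (t := 2 / 3) convex_P P321 P11); lra.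
Qed.

Lemma no_cutting_plane_proof (N : nat) (H : 'I_N -> set V) :
  ~ cutting_plane_proof (variable_disjunctions R (2 + m)) (P R m)
      (objective R m) 0 H.
Proof.
move=> [[D hD] bound].
have inv i : (i <= N)%N ->
    exists2 e, 0 < e & wedge (cp_relaxation (P R m) H i) e.
  elim: i => [_|i IH iN].
    exists (1 / 3); first lra.
    by have [? ? ? ?] := wedge_P; split; split.
  have [e e0 we] := IH (ltnW iN).
  exists (e / (1 + e)); first by rewrite divr_gt0//; lra.
  have [DD Hi] := hD (Ordinal iN).
  have cC : convex_set (cp_relaxation (P R m) H i).
    apply: (convex_setI convex_P); apply: convex_bigcap => j _.
    by case: (hD j) => _ [/convex_halfspace].
  have [w1 w2 w3 w4] := wedge_cut cC e0 we DD Hi.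
  have sub : cp_relaxation (P R m) H i `&` H (Ordinal iN) `<=`
             cp_relaxation (P R m) H i.+1.
    move=> x [[Px Hx] HNx]; split=> // j /=; rewrite ltnS leq_eqVlt.
    case/orP=> [/eqP ji|/Hx//].
    by rewrite (_ : j = Ordinal iN)//; exact: val_inj.
  by split; exact: sub.
have [e e0 [_ _ _ /bound]] := inv N (leqnn N).
by rewrite dot_obj_pt; lra.
Qed.

End Polytope.

(** * The separation between branch-and-bound and cutting planes *)

Theorem theorem2p4 (R : realType) :
  (forall m : nat,
     optimal_value (objective R m) (P R m `&` integer_points R (2 + m))
     = 0%:E) /\
  (exists A : forall m : nat, bb_state R (2 + m) -> bb_state R (2 + m),
   exists T : nat, forall m : nat,
     bb_algorithm (variable_disjunctions R (2 + m)) (integer_points R (2 + m))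
       (objective R m) (A m) /\
     bb_certifies (A m) (P R m) (objective R m) 0 T) /\
  (forall (m N : nat) (H : 'I_N -> set 'rV[R]_(2 + m)),
     ~ cutting_plane_proof (variable_disjunctions R (2 + m)) (P R m)
         (objective R m) 0 H).
Proof.
split; first by move=> m; exact: optimal_value_P.
split; last by move=> m N H; exact: no_cutting_plane_proof.
have strategy m : exists A : bb_state R (2 + m) -> bb_state R (2 + m),
    bb_algorithm (variable_disjunctions R (2 + m)) (integer_points R (2 + m))
      (objective R m) A /\
    bb_certifies A (P R m) (objective R m) 0 5.
  pose stop (s : bb_state R (2 + m)) :=
    if s is BBRun (_ :: _) _ then False else True.
  have [|s s' ss'|A [Astop Astep Areach]] := @shortest_path_strategy _
      (bb_step (variable_disjunctions R (2 + m)) (integer_points R (2 + m))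
         (objective R m)) stop (bb_certified (objective R m) 0).
  - case=> [[|N L] xbest|] live; [by case: live| |by case: live].
    exact: bb_step_total.
  - by case: ss' => - [|? ?] *; apply.
  exists A; split; last exact: Areach bb_reaches.
  by case=> [[|N L] xbest|]; [exact: Astop|exact: Astep|exact: Astop].
exists (fun m => sval (cid (strategy m))), 5%N => m.
exact: svalP (cid (strategy m)).
Qed.
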